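(* Let $p(x,y):=y(x-y^\ell)$, where $\ell\in\mathbb{N}$. Then, for every $n\ge\ell+1$, the generator family $\{1,p,-p\}$ satisfies property $\left(S_{n,\,\ell+\max\{\ell-1,2\}}\right)$.
   Context: Here $\mathbb{N}=\{1,2,\ldots\}$, $\mathbb{N}_0=\mathbb{N}\cup\{0\}$, $\mathcal{P}_m=\{f\in\mathbb{R}[x,y]:\deg f\le m\}$, and $\mathcal{Z}_p=\{(x,y)\in\mathbb{R}^2:p(x,y)=0\}$. A truncated (bivariate) sequence of degree $2n$ is a family of real numbers $\beta\equiv\beta^{(2n)}=\{\beta_{i,j}\}_{i,j\in\mathbb{N}_0,\,i+j\le 2n}$. Its Riesz functional is the linear map $L_\beta:\mathcal{P}_{2n}\to\mathbb{R}$ with $L_\beta(x^iy^j)=\beta_{i,j}$. Let $\mathcal{B}_m$ denote the set of monomials of degree at most $m$. The moment matrix $M(n)\equiv M(n;\beta)$ is the symmetric matrix indexed by $\mathcal{B}_n\times\mathcal{B}_n$ whose entry at monomials $(u,v)$ is $L_\beta(uv)$. For a polynomial $q$ of degree $\delta\le 2n$, the localizing matrix $M_q(n)\equiv M_q(n;\beta)$ is the symmetric matrix indexed by $\mathcal{B}_{n-\lceil\delta/2\rceil}\times\mathcal{B}_{n-\lceil\delta/2\rceil}$ whose entry at $(u,v)$ is $L_\beta(quv)$. For $k\in\mathbb{N}_0$, a positive extension of $M(n)$ of order $n+k$ is a moment matrix $M(n+k)\succeq 0$ (of some truncated sequence of degree $2(n+k)$) whose principal submatrix indexed by $\mathcal{B}_n$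 equals $M(n)$. Let $Q=\{q_0:=1,q_1,\ldots,q_m\}\subset\mathbb{R}[x,y]$ and $K_Q=\{z\in\mathbb{R}^2:q_i(z)\ge 0,\ i=0,\ldots,m\}$. A $K_Q$-representing measure for $\beta^{(2n)}$ is a positive Borel measure $\mu$ on $\mathbb{R}^2$ supported on $K_Q$ with $\beta_{i,j}=\int x^iy^j\,d\mu$ for all $i+j\le 2n$. The family $Q$ satisfies property $(S_{n,k})$ if, for every truncated sequence $\beta^{(2n)}$ of degree $2n$: $\beta^{(2n)}$ has a $K_Q$-representing measure if and only if $M(n)$ admits a positive extension $M(n+k)$ such that $M_{q_i}(n+k)\succeq 0$ for $i=1,\ldots,m$. For $Q=\{1,p,-p\}$ one has $K_Q=\mathcal{Z}_p$. *)

(* Defs.v *)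
From HB Require Import structures.
From mathcomp Require Import all_boot all_order all_algebra.
From mathcomp Require Import all_classical all_reals all_analysis.
(* The notations of mpoly clash with those of all_analysis. *)
From mathcomp Require Export -(notations) mpoly.

Set Implicit Arguments.
Unset Strict Implicit.
Unset Printing Implicit Defensive.

Import Order.TTheory GRing.Theory Num.Theory.

Local Open Scope classical_set_scope.
Local Open Scope ring_scope.

(* R[x, y] is {mpoly R[2]}, with x and y the variables of index 0 and 1. *)
Definition varX {R : realType} : mpoly 2 R := mpolyX R (mnm1 (0 : 'I_2)).
Definition varY {R : realType} : mpoly 2 R := mpolyX R (mnm1 (1 : 'I_2)).

Definition eval_at (R : realType) (f : mpoly 2 R) (z : R * R) : R :=
  meval (fun i : 'I_2 => if i == 0 then z.1 else z.2) f.

(* The exponents m of the monomials x ^ (m 0) * y ^ (m 1) in B_d, that is,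
   those with m 0 + m 1 < d + 1. *)
Definition monomials (d : nat) : finType := bmultinom 2 d.+1.

(* Truncated sequences of degree 2n: m is sent to beta_{m 0, m 1}. *)
Definition truncated_seq (R : realType) (n : nat) :=
  {ffun monomials (2 * n) -> R}.

(* The Riesz functional, extended by 0 to the monomials of degree > 2n. *)
Definition riesz (R : realType) (n : nat) (beta : truncated_seq R n)
    (f : mpoly 2 R) : R :=
  \sum_(m : monomials (2 * n)) mcoeff m f * beta m.

(* The i-th monomial of B_d; rows and columns are numbered along the
   enumeration of monomials d. *)
Definition monomial (R : realType) (d : nat) (i : 'I_#|monomials d|) :
  mpoly 2 R := mpolyX R (enum_val i).

Definition moment_mx (R : realType) (n : nat) (beta : truncated_seq R n) :
    'M[R]_#|monomials n| :=
  \matrix_(i, j) riesz beta (monomial R i * monomial R j).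

Definition degree (R : realType) (q : mpoly 2 R) : nat := (mpoly.msize q).-1.

(* Meaningful for degree q <= 2n; uphalf is the ceiling of the half. *)
Definition localizing_mx (R : realType) (n : nat) (beta : truncated_seq R n)
    (q : mpoly 2 R) : 'M[R]_#|monomials (n - uphalf (degree q))| :=
  \matrix_(i, j) riesz beta (q * monomial R i * monomial R j).

(* Only applied to moment and localizing matrices, symmetric by definition. *)
Definition psd (R : realType) (d : nat) (A : 'M[R]_d) : Prop :=
  forall v : 'cV[R]_d, 0 <= (v^T *m A *m v) 0 0.

Lemma widen_monomials_subproof (n k : nat) (m : monomials n) :
  (mdeg m < (n + k).+1)%N.
Proof. exact: leq_trans (bmdeg m) (leq_addr k n.+1). Qed.

Definition widen_monomials (n k : nat) (m : monomials n) : monomials (n + k) :=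
  BMultinom (widen_monomials_subproof k m).

Definition widen_index (n k : nat) (i : 'I_#|monomials n|) :
    'I_#|monomials (n + k)| :=
  enum_rank (widen_monomials k (enum_val i)).

Definition positive_extension (R : realType) (n k : nat)
    (beta : truncated_seq R n) (beta' : truncated_seq R (n + k)) : Prop :=
  psd (moment_mx beta') /\
  mxsub (widen_index k) (widen_index k) (moment_mx beta') = moment_mx beta.

Definition K_set (R : realType) (Q : seq (mpoly 2 R)) : set (R * R) :=
  [set z | forall q, q \in Q -> 0 <= eval_at q z].

(* The product sigma-algebra on R * R is the Borel sigma-algebra of R^2. *)
Definition representing_measure (R : realType) (Q : seq (mpoly 2 R)) (n : nat)
    (beta : truncated_seq R n) (mu : {measure set (R * R) -> \bar R}) : Prop :=
  mu (~` K_set Q) = 0%E /\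
  forall m : monomials (2 * n),
    mu.-integrable [set: R * R]
      (fun z => (z.1 ^+ m 0%R * z.2 ^+ m 1%R)%:E) /\
    (\int[mu]_z (z.1 ^+ m 0%R * z.2 ^+ m 1%R)%:E)%E = (beta m)%:E.

(* Property (S_{n,k}) of a family Q = [:: q_0; q_1; ...; q_m] with q_0 = 1;
   behead Q consists of q_1, ..., q_m. *)
Definition property_S (R : realType) (n k : nat) (Q : seq (mpoly 2 R)) : Prop :=
  forall beta : truncated_seq R n,
    (exists mu : {measure set (R * R) -> \bar R},
       representing_measure Q beta mu) <->
    (exists beta' : truncated_seq R (n + k),
       positive_extension beta beta' /\
       forall q, q \in behead Q -> psd (localizing_mx beta' q)).

(* Main.v *)
From HB Require Import structures.
Require Import Defs.
From mathcomp Require Import all_boot all_order all_algebra.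
From mathcomp Require Import all_classical all_reals all_analysis.
From mathcomp Require Import measurable_realfun complex.
From mathcomp Require Import ring lra zify.

Set Implicit Arguments.
Unset Strict Implicit.
Unset Printing Implicit Defensive.

Import Order.TTheory GRing.Theory Num.Theory.
Import numFieldNormedType.Exports.
Local Open Scope classical_set_scope.
Local Open Scope ring_scope.

(** The zero set of p = y (x - y^l) is the union of the line y = 0 and of the
    curve x = y^l, which meet at the origin.  A sequence has a representing
    measure on it exactly when its vector of moments is a conical combination of
    vectors of monomials evaluated at points of it.  Membership in such a cone is
    decided by [cone_of_facial_positivity]: a vector v is in the cone of X as soon
    as X is good, for some class of good sets such that every f that is
    nonnegative on a good set Y has v(f) >= 0, and, if v(f) = 0, the zeros of f in
    Y form a good set again.  The cones need not be closed, so the proof separates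
    algebraically and descends on the dimension.

    From a measure to an extension, the good sets are those of full measure.  The
    sequence then comes from finitely many atoms ([measure_cone]), and these have
    moments in every degree.

    From an extension to a measure, put h = 1 + x^(2n+2) + y^(2n+2).  The good sets
    are the closed sets Y such that L(g + e h) >= 0 for all g of degree 2n and
    e > 0 with g + e h >= 0 on Y, where L is the Riesz functional of the extension
    ([cone_of_perturbed_positivity]).  It remains to see that L is nonnegative on
    each f of degree 2n + 2 that is nonnegative on the zero set of p
    ([positive_on_curve]).  Modulo p, f is the pair of its restrictions
    a(x) = f(x, 0) and b(y) = f(y^l, y), with a(0) = b(0).  Both are nonnegative in
    one variable, hence sums of two squares, and a rotation lets the two
    representations agree at the origin ([nonneg_sum_two_squares_at0]).  They glue
    to f = g1^2 + g2^2 modulo p, where g1 and g2 can be chosen of degree n + l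
    because y^l may be traded for x in every multiple of y ([msize_curve_lift]).
    Finally, the localizing conditions for p and - p say that L vanishes on the
    multiples of p of controlled degree, so L(f) = L(g1^2) + L(g2^2) >= 0
    ([L_normal_form]). *)

(** * Convex cones in finite dimension *)

Section Cones.
Context {R : realType} {N : nat}.
Implicit Types (P Q : set 'rV[R]_N) (x y v : 'rV[R]_N) (f : 'cV[R]_N).

Definition pair v f : R := (v *m f) 0 0.

Lemma pairD x y f : pair (x + y) f = pair x f + pair y f.
Proof. by rewrite /pair mulmxDl mxE. Qed.
Lemma pairN x f : pair (- x) f = - pair x f.
Proof. by rewrite /pair mulNmx mxE. Qed.
Lemma pairB x y f : pair (x - y) f = pair x f - pair y f.
Proof. by rewrite pairD pairN. Qed.
Lemma pairZ (c : R) x f : pair (c *: x) f = c * pair x f.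
Proof. by rewrite /pair -scalemxAl mxE. Qed.
Lemma pair0 f : pair 0 f = 0.
Proof. by rewrite /pair mul0mx mxE. Qed.
Lemma pairDr x (f g : 'cV_N) : pair x (f + g) = pair x f + pair x g.
Proof. by rewrite /pair mulmxDr mxE. Qed.
Lemma pairZr (c : R) x f : pair x (c *: f) = c * pair x f.
Proof. by rewrite /pair -scalemxAr mxE. Qed.
Lemma pairNr x f : pair x (- f) = - pair x f.
Proof. by rewrite /pair mulmxN [LHS]mxE. Qed.
Lemma pairE x f : pair x f = \sum_i x 0 i * f i 0.
Proof. by rewrite /pair mxE. Qed.

Definition convex_cone P : Prop :=
  [/\ P 0, forall x y, P x -> P y -> P (x + y)
    & forall (c : R) x, 0 <= c -> P x -> P (c *: x)].

Lemma convex_cone_sum P (I : Type) (r : seq I) (p : pred I) (F : I -> 'rV_N) :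
  convex_cone P -> (forall i, p i -> P (F i)) -> P (\sum_(i <- r | p i) F i).
Proof. by move=> [P0 PD _] PF; elim/big_ind : _. Qed.

Definition lineality P x : Prop := P x /\ P (- x).

Lemma cone_scale_ge0 P e : convex_cone P -> ~ P (- e) ->
  forall c : R, P (c *: e) -> 0 <= c.
Proof.
move=> [P0 PD PZ] NPe c Pce; rewrite leNgt; apply/negP => c0; apply: NPe.
have -> : - e = (- c)^-1 *: (c *: e).
  by rewrite scalerA invrN mulNr mulVf ?scaleN1r// lt_eqF.
by apply: PZ => //; rewrite invr_ge0; lra.
Qed.

Lemma lineality_sum P (d : nat) (c : 'I_d -> R) (F : 'I_d -> 'rV_N) :
  convex_cone P -> (forall i, lineality P (F i)) ->
  lineality P (\sum_i c i *: F i).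
Proof.
move=> cP PF; rewrite /lineality -sumrN.
by have [P0 PD PZ] := cP; split; apply: convex_cone_sum => // i _;
  case: (PF i) => P1 P2;
  have [ci|/ltW ci] := leP 0 (c i); rewrite -?scalerN;
  do ?[exact: PZ | by rewrite -[_ *: _]opprK -scaleNr -scalerN ?opprK;
    apply: PZ => //; rewrite oppr_ge0].
Qed.

(** The value a functional normalised by e may take at x must lie above every t
    with x - t e in P; the supremum t of those works, in the sense that the line
    spanned by x - t e can be added to P without reaching - e. *)
Lemma adjoin_line P e x : convex_cone P -> ~ P (- e) -> P x -> P (e - x) ->
  exists Q (t : R), [/\ P `<=` Q, convex_cone Q, ~ Q (- e) &
    lineality Q (x - t *: e)].
Proof.
move=> cP NPe Px Pex; have [P0 PD PZ] := cP.
have PZe := cone_scale_ge0 cP NPe.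
pose T := [set t : R | P (x - t *: e)].
have T0 : T 0 by rewrite /T/= scale0r subr0.
have ubT : ubound T 1.
  move=> t Tt; rewrite -subr_ge0; apply: PZe.
  have -> : (1 - t) *: e = (e - x) + (x - t *: e).
    by rewrite scalerBl scale1r addrA subrK.
  exact: PD.
have sT : has_sup T by split; [exists 0 | exists 1].
pose t := sup T.
have tub s : P (x - s *: e) -> s <= t by move=> Ps; apply: ub_le_sup => //; exists 1.
exists [set y | exists s, P (y + s *: (x - t *: e))], t; split.
- by move=> y Py; exists 0; rewrite scale0r addr0.
- split.
  + by exists 0; rewrite scale0r addr0.
  + move=> y z [a Pa] [b Pb]; exists (a + b).
    by rewrite scalerDl addrACA; exact: PD.
  + move=> c y c0 [a Pa]; exists (c * a).
    by rewrite -scalerA -scalerDr; exact: PZ.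
- move=> [s Ps].
  have [s0|s0|s0] := ltgtP s 0.
  + (* the supremum is approached within 1 / (- s), which puts a negative
       multiple of e in P *)
    have r0 : 0 < (- s)^-1 by rewrite invr_gt0; lra.
    have [a Ta ta] := sup_adherent r0 sT.
    have /PZe : P ((t - a - (- s)^-1) *: e).
      have -> : (t - a - (- s)^-1) *: e =
          (- s)^-1 *: (- e + s *: (x - t *: e)) + (x - a *: e).
        by apply/rowP => i; rewrite !mxE; field; rewrite lt_eqF.
      by apply: PD => //; apply: PZ => //; exact: ltW.
    by rewrite -/t in ta; lra.
  + (* t + 1 / s would be a larger candidate *)
    have := tub (t + s^-1).
    have -> : x - (t + s^-1) *: e = s^-1 *: (- e + s *: (x - t *: e)).
      by apply/rowP => i; rewrite !mxE; field; rewrite gt_eqF.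
    have r0 : 0 < s^-1 by rewrite invr_gt0.
    by move/(_ (PZ _ _ (ltW r0) Ps)); lra.
  + by apply: NPe; move: Ps; rewrite s0 scale0r addr0.
- by split; [exists (-1); rewrite scaleN1r subrr | exists 1; rewrite scale1r addNr].
Qed.

Lemma adjoin_lines P e (s : seq 'rV[R]_N) :
  convex_cone P -> ~ P (- e) ->
  (forall x, x \in s -> P x /\ P (e - x)) ->
  exists Q, [/\ P `<=` Q, convex_cone Q, ~ Q (- e) &
    forall x, x \in s -> exists t : R, lineality Q (x - t *: e)].
Proof.
elim: s P => [|x s IH] P cP NPe Ps; first by exists P; split.
have [Px Pex] := Ps x (mem_head _ _).
have [Q [t [PQ cQ NQe [Q1 Q2]]]] := adjoin_line cP NPe Px Pex.
have [|Q' [QQ' cQ' NQ'e Q's]] := IH Q cQ NQe.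
  move=> y ys; have [Py Pey] := Ps y (mem_behead (ys : y \in behead (x :: s))).
  by split; exact: PQ.
exists Q'; split => //; first exact: subset_trans QQ'.
move=> y; rewrite inE => /orP[/eqP ->|/Q's//].
by exists t; split; exact: QQ'.
Qed.

Lemma spanning_rows P : exists d (B : 'M[R]_(d, N)),
  [/\ row_free B, forall i, P (row i B) & forall x, P x -> (x <= B)%MS].
Proof.
pose good d := `[< exists B : 'M[R]_(d, N), row_free B /\ forall i, P (row i B) >].
have ex_good : exists d, good d.
  by exists 0%N; apply/asboolP; exists 0; split=> [|[]//]; rewrite /row_free mxrank0.
have ub_good d : good d -> (d <= N)%N.
  by move=> /asboolP[B [/eqP fB _]]; rewrite -[leqLHS]fB rank_leq_col.
case: (ex_maxnP ex_good ub_good) => d /asboolP[B [fB PB]] max_d.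
exists d, B; split=> // x Px; apply: contrapT => /negP xB.
suff /max_d : good (d + 1)%N by rewrite addn1 ltnn.
apply/asboolP; exists (col_mx B x); split; last first.
  move=> k; rewrite -[k]splitK; case: (fintype.split k) => j /=.
    by rewrite rowKu.
  by rewrite rowKd row_id.
rewrite /row_free eqn_leq rank_leq_row /=.
suff : (\rank B < \rank (col_mx B x))%N.
  by apply: leq_trans; rewrite (eqP fB) addn1.
have BBx : (B <= col_mx B x)%MS.
  by apply: submx_trans (addsmxSl B x) _; rewrite addsmxE.
by rewrite (ltn_leqif (mxrank_leqif_sup BBx)) col_mx_sub submx_refl.
Qed.

(** No closure of P is taken: a convex cone in finite dimension that is not a
    linear subspace is supported by a functional that is not zero on it.  The
    functional is built on a basis of the span of P chosen inside P.  The sum e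
    of this basis dominates each basis vector, so the values can be fixed one
    basis vector after another. *)
Lemma positive_functional P p : convex_cone P -> P p -> ~ P (- p) ->
  exists f, (forall x, P x -> 0 <= pair x f) /\ exists2 x, P x & 0 < pair x f.
Proof.
move=> cP Pp NPp; have [P0 PD PZ] := cP.
have [d [B [fB PB spanB]]] := spanning_rows P.
pose e := \sum_i row i B.
have eE i : e - row i B = \sum_(j | j != i) row j B.
  by rewrite /e (bigD1 i)//= addrC addrK.
have NPe : ~ P (- e).
  move=> Pe; apply: NPp.
  have PNB i : P (- row i B).
    have -> : - row i B = - e + \sum_(j | j != i) row j B.
      by rewrite -eE addKr.
    by apply: PD => //; apply: convex_cone_sum.
  have /submxP[u ->] := spanB _ Pp; rewrite mulmx_sum_row -sumrN.
  apply: convex_cone_sum => // i _; have [u0|u0] := leP 0 (u 0 i).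
    by rewrite -scalerN; exact: PZ.
  by rewrite -scaleNr; apply: PZ => //; rewrite oppr_ge0 ltW.
have [|Q [PQ cQ NQe Qs]] :=
    @adjoin_lines P e [seq row i B | i <- enum 'I_d] cP NPe.
  move=> _ /mapP[i _ ->]; split=> //; rewrite eE.
  exact: convex_cone_sum.
have [Q0 QD QZ] := cQ.
have /choice[t Qt] : forall i, exists t : R, lineality Q (row i B - t *: e).
  by move=> i; apply: Qs; apply: map_f; rewrite mem_enum.
pose f := pinvmx B *m \col_i t i.
have Qf x : (x <= B)%MS -> lineality Q (x - pair x f *: e).
  move=> xB; set u := x *m pinvmx B.
  have -> : x - pair x f *: e = \sum_i u 0 i *: (row i B - t i *: e).
    under eq_bigr do rewrite scalerBr scalerA.
    rewrite sumrB -mulmx_sum_row mulmxKpV// -scaler_suml; congr (_ - _ *: _).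
    by rewrite /pair /f mulmxA mxE; apply: eq_bigr => i _; rewrite [X in _ * X]mxE.
  exact: lineality_sum.
exists f; split=> [x Px|].
  have [_ Qx] := Qf _ (spanB _ Px); apply: (cone_scale_ge0 cQ NQe).
  by rewrite -[_ *: _](subrK x) -[_ - x]opprB; apply: QD => //; exact: PQ.
have eB : (e <= B)%MS by apply: summx_sub => i _; exact: row_sub.
exists e; first exact: convex_cone_sum.
have [_ ] := Qf e eB.
have -> : - (e - pair e f *: e) = (pair e f - 1) *: e.
  by rewrite scalerBl scale1r opprB.
by move=> /(cone_scale_ge0 cQ NQe); lra.
Qed.

End Cones.

Section PointCones.
Context {R : realType} {N : nat} {T : Type} (ev : T -> 'rV[R]_N).
Implicit Types (X : set T) (v : 'rV[R]_N) (f : 'cV[R]_N).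

(** The conical hull of the vectors [ev z], for z in X. *)
Inductive cone X : 'rV[R]_N -> Prop :=
| cone0 : cone X 0
| coneD c z v of 0 <= c & X z & cone X v : cone X (c *: ev z + v).

Lemma cone_convex X : convex_cone (cone X).
Proof.
split; first exact: cone0.
- move=> x y; elim=> [|c z v c0 Xz _ IH] Xy; first by rewrite add0r.
  by rewrite -addrA; apply: coneD => //; exact: IH.
- move=> c x c0; elim=> [|d z v d0 Xz _ IH]; first by rewrite scaler0; exact: cone0.
  by rewrite scalerDr scalerA; apply: coneD => //; rewrite mulr_ge0.
Qed.

Lemma sub_cone X Y v : X `<=` Y -> cone X v -> cone Y v.
Proof.
move=> XY; elim=> [|c z {}v c0 Xz _ Yv]; first exact: cone0.
by apply: coneD => //; exact: XY.
Qed.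

Lemma cone_pair_ge0 X v f : cone X v ->
  (forall z, X z -> 0 <= pair (ev z) f) -> 0 <= pair v f.
Proof.
move=> + Xf; elim=> [|c z {}v c0 Xz _ v0]; first by rewrite pair0.
by rewrite pairD pairZ addr_ge0// mulr_ge0// Xf.
Qed.

Lemma cone_point X z : X z -> cone X (ev z).
Proof.
move=> Xz; rewrite -[ev z]scale1r -[_ *: _]addr0.
by apply: coneD => //; exact: cone0.
Qed.

(** The last alternative says that f is not zero on the span of v and of the
    generators; without it f = 0 would do.  It is what makes the dimension drop
    in [cone_of_facial_positivity]. *)
Lemma cone_separation X v : ~ cone X v ->
  exists f, [/\ forall z, X z -> 0 <= pair (ev z) f, pair v f <= 0 &
    pair v f < 0 \/ exists2 z, X z & 0 < pair (ev z) f].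
Proof.
move=> Xv; have [X0 XD XZ] := cone_convex X.
(* P cannot be a linear subspace: v in P would give v = c - t v with c in the
   cone, hence v = c / (1 + t) in the cone *)
pose P := [set x | exists c (t : R), [/\ cone X c, 0 <= t & x = c - t *: v]].
have cP : convex_cone P.
  split.
  - by exists 0, 0; split=> //; rewrite scale0r subr0.
  - move=> _ _ [c [t [Xc t0 ->]]] [d [s [Xd s0 ->]]].
    exists (c + d), (t + s); split; [exact: XD | exact: addr_ge0 |].
    by rewrite scalerDl opprD addrACA.
  - move=> a _ a0 [c [t [Xc t0 ->]]]; exists (a *: c), (a * t).
    by split; [exact: XZ | exact: mulr_ge0 | rewrite scalerBr scalerA].
have PNv : P (- v) by exists 0, 1; split=> //; rewrite scale1r sub0r.
have Pv : ~ P (- - v).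
  rewrite opprK => -[c [t [Xc t0 vE]]]; apply: Xv.
  have t1 : 0 < 1 + t by lra.
  have -> : v = (1 + t)^-1 *: c.
    have -> : c = (1 + t) *: v by rewrite scalerDl scale1r {1}vE subrK.
    by rewrite scalerA mulVf ?scale1r// gt_eqF.
  by apply: XZ => //; rewrite invr_ge0 ltW.
have [f [Pf [x [c [t [Xc t0 xE]]] xf]]] := positive_functional cP PNv Pv.
have vf : pair v f <= 0 by have := Pf _ PNv; rewrite pairN oppr_ge0.
have Xf z : X z -> 0 <= pair (ev z) f.
  move=> Xz; apply: Pf; exists (ev z), 0; split => //; first exact: cone_point.
  by rewrite scale0r subr0.
exists f; split=> //.
have [vf0|vf0] := ltP (pair v f) 0; [by left | right].
have vfz : pair v f = 0 by apply/eqP; rewrite eq_le vf.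
apply: contrapT => NX; move: xf.
rewrite xE pairB pairZ vfz mulr0 subr0 ltNge => /negP; apply.
rewrite -oppr_ge0 -pairNr; apply: (cone_pair_ge0 Xc) => z Xz.
by rewrite pairNr oppr_ge0 leNgt; apply/negP => zf; apply: NX; exists z.
Qed.

(** If v is outside the cone of X, a separating functional f is nonnegative on X
    with [pair v f <= 0], so [pair v f = 0] and the zeros of f in X form another
    good set.  They span less than X does, so the descent ends. *)
Lemma cone_of_facial_positivity (Good : set T -> Prop) v :
  (forall X, Good X -> forall f, (forall z, X z -> 0 <= pair (ev z) f) ->
     0 <= pair v f /\ (pair v f = 0 -> Good [set z | X z /\ pair (ev z) f = 0])) ->
  forall X, Good X -> cone X v.
Proof.
move=> Gpos X GX.
suff rec d (B : 'M[R]_N) : (\rank B < d)%N -> forall X, Good X ->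
    (forall z, X z -> (ev z <= B)%MS) -> cone X v.
  by apply: (rec _ 1%:M (ltnSn _) X GX) => z _; exact: submx1.
elim: d B {X GX} => // d IH B rB X GX XB.
apply: contrapT => NXv; have [f [Xf vf]] := cone_separation NXv.
have [vf0 GXf] := Gpos X GX f Xf.
have vfz : pair v f = 0 by apply/eqP; rewrite eq_le vf.
rewrite vfz ltxx => -[//|[z Xz zf]].
have zNf : ~~ (B <= kermx f)%MS.
  apply/negP => Bf; move: zf; have /sub_kermxP zf0 := submx_trans (XB z Xz) Bf.
  by rewrite /pair zf0 mxE ltxx.
(* the span of the zeros of f lies in that of X and in the kernel of f *)
have lt_rk : (\rank (B :&: kermx f)%MS < d)%N.
  rewrite -ltnS (leq_trans _ rB)// ltnS.
  rewrite (ltn_leqif (mxrank_leqif_sup (capmxSl _ _))).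
  by rewrite sub_capmx submx_refl.
apply: NXv; apply: (@sub_cone [set z | X z /\ pair (ev z) f = 0]).
  by move=> ? [].
apply: (IH _ lt_rk _ (GXf vfz)) => y [Xy yf]; rewrite sub_capmx XB//=.
by apply/sub_kermxP/matrixP => i j; rewrite !ord1 [RHS]mxE.
Qed.

End PointCones.

(** * Monomials, the Riesz functional and its matrices *)

Section Monomials.
Context {R : realType}.
Implicit Types (f g q : mpoly 2 R) (z : R * R) (d n : nat).

Definition mon (i j : nat) : multinom 2 :=
  mnm_add (mnm_muln (mnm1 0) i) (mnm_muln (mnm1 1) j).

Lemma mon0 i j : mon i j 0 = i.
Proof. by rewrite mnmDE !mulmnE !mnm1E eqxx mul1n mul0n addn0. Qed.

Lemma mon1 i j : mon i j 1 = j.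
Proof. by rewrite mnmDE !mulmnE !mnm1E eqxx mul1n mul0n add0n. Qed.

Lemma monE (m : multinom 2) : m = mon (m 0) (m 1).
Proof.
apply/mnmP => k; have [->|->] : k = 0 \/ k = 1.
  by case: k => -[|[|//]] ?; [left|right]; apply/val_inj.
- by rewrite mon0.
- by rewrite mon1.
Qed.

Lemma monD i j i' j' : mnm_add (mon i j) (mon i' j') = mon (i + i') (j + j').
Proof. by rewrite [LHS]monE; congr mon; rewrite mnmDE ?mon0 ?mon1. Qed.

Lemma mdeg_mon i j : mdeg (mon i j) = (i + j)%N.
Proof. by rewrite mdegD !mdegMn !mdeg1 !mul1n. Qed.

Lemma eval_atX m z : eval_at (mpolyX R m) z = z.1 ^+ m 0 * z.2 ^+ m 1.
Proof.
rewrite /eval_at mevalX big_ord_recl big_ord1 /=.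
by congr (_ ^+ m _ * _ ^+ m _); exact/val_inj.
Qed.

Lemma monX i j : mpolyX R (mon i j) = varX ^+ i * varY ^+ j.
Proof. by rewrite mpolyXD -!mpolyXn. Qed.

Definition evals d z : 'rV[R]_#|monomials d| :=
  \row_i eval_at (monomial R i) z.

Definition coefs d f : 'cV[R]_#|monomials d| := \col_i mcoeff (enum_val i : monomials d) f.

Definition of_coefs d (v : 'cV[R]_#|monomials d|) : mpoly 2 R :=
  \sum_i v i 0 *: monomial R i.

Lemma coefsK d f : (msize f <= d.+1)%N -> of_coefs (coefs d f) = f.
Proof.
move=> fd; rewrite [RHS](mpolywE fd) /of_coefs.
rewrite [RHS](reindex _ (onW_bij _ (@enum_val_bij _))) /=.
by apply: eq_bigr => i _; rewrite mxE.
Qed.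

Lemma msize_of_coefs d (v : 'cV[R]_#|monomials d|) :
  (msize (of_coefs v) <= d.+1)%N.
Proof.
apply: leq_trans (msize_sum _ _ _) _; apply/bigmax_leqP_seq => i _ _.
by apply: leq_trans (msizeZ_le _ _) _; rewrite msizeX; exact: bmdeg.
Qed.

Lemma pair_evals d f z : (msize f <= d.+1)%N ->
  pair (evals d z) (coefs d f) = eval_at f z.
Proof.
move=> fd; rewrite -[in RHS](coefsK fd) /eval_at /of_coefs raddf_sum pairE /=.
by apply: eq_bigr => i _; rewrite mevalZ mulrC; congr (_ * _); rewrite mxE.
Qed.

End Monomials.

Section Riesz.
Context {R : realType}.
Implicit Types (f g q : mpoly 2 R) (z : R * R) (d n : nat).

Definition moments n (beta : truncated_seq R n) :
  'rV[R]_#|monomials (2 * n)| := \row_i beta (enum_val i).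

Lemma pair_moments n (beta : truncated_seq R n) f :
  pair (moments beta) (coefs (2 * n) f) = riesz beta f.
Proof.
rewrite pairE /riesz [RHS](reindex _ (onW_bij _ (@enum_val_bij _))) /=.
by apply: eq_bigr => i _; rewrite !mxE mulrC.
Qed.

Lemma riesz_is_linear n (beta : truncated_seq R n) :
  linear (riesz beta : mpoly 2 R -> R^o).
Proof.
move=> c f g; rewrite -!pair_moments.
have -> : coefs (2 * n) (c *: f + g) = c *: coefs (2 * n) f + coefs (2 * n) g.
  by apply/matrixP => i j; rewrite !mxE mcoeffD mcoeffZ.
by rewrite pairDr pairZr.
Qed.

HB.instance Definition _ n (beta : truncated_seq R n) :=
  GRing.isLinear.Build R (mpoly 2 R) R^o _ (riesz beta) (riesz_is_linear beta).

Lemma rieszX n (beta : truncated_seq R n) (m : monomials (2 * n)) :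
  riesz beta (mpolyX R m) = beta m.
Proof.
rewrite /riesz (bigD1 m)//= mcoeffX eqxx mul1r big1 ?addr0// => m' m'm.
by rewrite mcoeffX -bmeqP eq_sym (negbTE m'm) mul0r.
Qed.

Lemma riesz_quadratic n (beta : truncated_seq R n) q d
    (v : 'cV[R]_#|monomials d|) :
  (v^T *m (\matrix_(i, j) riesz beta (q * monomial R i * monomial R j)) *m v) 0 0
  = riesz beta (q * of_coefs v * of_coefs v).
Proof.
rewrite mxE [in RHS]/of_coefs mulr_sumr raddf_sum; apply: eq_bigr => j _ /=.
rewrite -scalerAr linearZ /= mulrC; congr (_ * _).
rewrite mulr_sumr mulr_suml raddf_sum mxE; apply: eq_bigr => i _ /=.
by rewrite -scalerAr -scalerAl linearZ !mxE.
Qed.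

(** A quadratic form in the coefficients of f is the functional applied to q f^2,
    so that positivity of moment and localizing matrices no longer mentions
    matrices. *)
Lemma psd_quadratic n (beta : truncated_seq R n) q d (M : 'M[R]_#|monomials d|) :
  (forall i j, M i j = riesz beta (q * monomial R i * monomial R j)) ->
  psd M <-> forall f, (msize f <= d.+1)%N -> 0 <= riesz beta (q * f * f).
Proof.
move=> ME; have -> : M = \matrix_(i, j) riesz beta (q * monomial R i * monomial R j).
  by apply/matrixP => i j; rewrite mxE ME.
split=> [Mpsd f fd|qpos v].
  by have := Mpsd (coefs d f); rewrite riesz_quadratic coefsK.
by rewrite riesz_quadratic; apply: qpos; exact: msize_of_coefs.
Qed.

Lemma psd_momentP n (beta : truncated_seq R n) :
  psd (moment_mx beta) <->
  forall f, (msize f <= n.+1)%N -> 0 <= riesz beta (f * f).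
Proof.
rewrite (@psd_quadratic _ beta 1) => [|i j]; last by rewrite mxE mul1r.
by split=> H f /H; rewrite mul1r.
Qed.

Lemma psd_localizingP n (beta : truncated_seq R n) q :
  psd (localizing_mx beta q) <->
  forall f, (msize f <= (n - uphalf (degree q)).+1)%N ->
    0 <= riesz beta (q * f * f).
Proof. by rewrite (@psd_quadratic _ beta q) => // i j; rewrite mxE. Qed.

(** What links the entries of M(n), indexed by pairs of monomials of degree n, to
    the whole sequence of degree 2n. *)
Lemma monomial_split n (m : monomials (2 * n)) :
  exists m1 m2 : monomials n, val m = mnm_add m1 m2.
Proof.
case: m => m /=; rewrite [m]monE mdeg_mon ltnS.
move: (m 0) (m 1) => i j le_ij.
have d1 : (mdeg (mon (minn i n) (minn j (n - minn i n))) < n.+1)%N.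
  by rewrite mdeg_mon; lia.
have d2 : (mdeg (mon (i - minn i n) (j - minn j (n - minn i n))) < n.+1)%N.
  by rewrite mdeg_mon; lia.
by exists (BMultinom d1), (BMultinom d2) => /=; rewrite monD; congr mon; lia.
Qed.

Lemma positive_extensionP n k (beta : truncated_seq R n)
    (beta' : truncated_seq R (n + k)) :
  positive_extension beta beta' <->
  (forall f, (msize f <= (n + k).+1)%N -> 0 <= riesz beta' (f * f)) /\
  (forall f, (msize f <= (2 * n).+1)%N -> riesz beta' f = riesz beta f).
Proof.
rewrite /positive_extension psd_momentP; split=> -[pos ext]; split=> //.
  have rX (m : monomials (2 * n)) :
      riesz beta' (mpolyX R m) = riesz beta (mpolyX R m).
    have [m1 [m2 /= ->]] := monomial_split m.
    have /matrixP/(_ (enum_rank m1) (enum_rank m2)) := ext.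
    by rewrite !mxE /monomial /widen_index !enum_rankK -!mpolyXD.
  move=> f fd; rewrite (mpolywE fd) !raddf_sum; apply: eq_bigr => m _.
  by rewrite /= !linearZ /= rX.
apply/matrixP => i j; rewrite !mxE /monomial /widen_index !enum_rankK -!mpolyXD.
apply: ext; rewrite msizeX ltnS mdegD mul2n -addnn.
by apply: leq_add; rewrite -ltnS; exact: (bmdeg (enum_val _ : monomials n)).
Qed.

End Riesz.

(** * Nonnegative polynomials in one variable *)

Section SumsOfSquares.
Context {R : realType}.
Implicit Types (a b q u v : {poly R}).

Lemma horner_right_ge0 q (s : R) : (forall x, s < x -> 0 <= q.[x]) -> 0 <= q.[s].
Proof.
move=> qs; rewrite leNgt; apply/negP => q0.
have /cvgr_lt /(_ _ q0) near_s : q.[x] @[x --> s] --> q.[s] by exact: continuous_horner.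
have near_s' : \forall x \near s^'+, q.[x] < 0 by exact: cvg_within near_s.
have [x [sx qx]] : exists x, s < x /\ q.[x] < 0.
  have : \forall x \near s^'+, s < x /\ q.[x] < 0.
    by near=> x; split; near: x => //; exact: nbhs_right_gt.
  by move=> /filter_ex.
by have := qs _ sx; rewrite leNgt qx.
Unshelve. all: by end_near. Qed.

(** A complex root s + i t of a annihilates D = (X - s)^2 + t^2, hence also the
    affine remainder of a modulo D.  If t is not zero this forces the remainder
    to vanish.  If t = 0 it only gives a root s of a, and nonnegativity makes the
    multiplicity even. *)
Lemma quadratic_factor a : (forall x, 0 <= a.[x]) -> (1 < size a)%N ->
  exists s t : R, ('X - s%:P) ^+ 2 + (t ^+ 2)%:P %| a.
Proof.
move=> a0 sa.
have [z /rootP az] : exists z, root (map_poly (real_complex R) a) z.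
  by apply/closed_rootP; rewrite size_map_poly; case: (size a) sa => [|[]].
case: z az => s t az; exists s, t.
set D := _ + _.
have sD : size D = 3%N.
  rewrite /D size_polyDl size_exp_XsubC// size_polyC; case: eqP => //.
have sr : (size (a %% D)%R <= 2)%N.
  by rewrite -ltnS -sD ltn_modp -size_poly_eq0 sD.
set r := a %% D in sr.
have rE : r = r`_1 *: 'X + (r`_0)%:P.
  apply/polyP => -[|[|i]]; rewrite coefD coefZ coefX coefC ?mulr0 ?add0r ?mulr1 ?addr0//.
  by rewrite nth_default// (leq_trans sr).
have aE : a = a %/ D * D + r by exact: divp_eq.
have Dz : (map_poly (real_complex R) D).[s +i* t]%C = 0.
  rewrite rmorphD rmorphXn rmorphB /= map_polyX !map_polyC /= !hornerE.
  by apply/eqP; rewrite eq_complex /=; apply/andP; split; apply/eqP; ring.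
move: az; rewrite {1}aE rmorphD rmorphM hornerD hornerM Dz mulr0 add0r rE.
rewrite rmorphD /= map_polyZ /= map_polyX map_polyC /= !hornerE => /eqP.
rewrite eq_complex /= => /andP[/eqP rs /eqP rt].
have {}rt : r`_1 * t = 0 by move: rt; rewrite mul0r !addr0.
have {}rs : r`_1 * s + r`_0 = 0 by move: rs; rewrite mul0r subr0.
suff r1 : r`_1 = 0.
  apply/modp_eq0P; rewrite -/r rE r1 scale0r add0r.
  by move: rs; rewrite r1 mul0r add0r => ->.
move/eqP: rt; rewrite mulf_eq0 => /orP[/eqP //|/eqP t0].
(* a real root s: the cofactor of X - s changes sign with X - s *)
pose a1 := (a %/ D) * ('X - s%:P) + (r`_1)%:P.
have a1E x : a.[x] = (x - s) * a1.[x].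
  have r0 : r`_0 = - (r`_1 * s) by apply/eqP; rewrite -addr_eq0 addrC rs.
  have DE : D.[x] = (x - s) ^+ 2 by rewrite /D t0 !hornerE; ring.
  rewrite {1}aE rE r0 [LHS]hornerD hornerM DE /a1.
  by rewrite !(hornerD, hornerN, hornerM, hornerZ, hornerX, hornerC); ring.
have a1s : a1.[s] = r`_1 by rewrite /a1 !hornerE subrr mulr0 add0r.
clearbody a1; apply/eqP; rewrite eq_le -{1}oppr_ge0 -a1s; apply/andP; split.
  have -> : - a1.[s] = (- a1 \Po ((2 * s)%:P - 'X)).[s].
    by rewrite horner_comp !hornerE; congr (- a1.[_]); ring.
  apply: horner_right_ge0 => x sx; rewrite horner_comp !hornerE oppr_ge0.
  have := a0 (2 * s - x); rewrite a1E; nra.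
by apply: horner_right_ge0 => x sx; have := a0 x; rewrite a1E; nra.
Qed.

(** Sums of two squares are closed under products by the Brahmagupta identity, and
    the factors of [quadratic_factor] are such sums. *)
Lemma nonneg_sum_two_squares k a : (forall x, 0 <= a.[x]) ->
  (size a <= k.*2.+1)%N ->
  exists u v, [/\ (size u <= k.+1)%N, (size v <= k.+1)%N & a = u ^+ 2 + v ^+ 2].
Proof.
elim: k a => [|k IH] a a0 sa.
  rewrite (size1_polyC sa); have c0 : 0 <= a`_0.
    by have := a0 0; rewrite horner_coef0.
  exists (Num.sqrt a`_0)%:P, 0.
  by rewrite size_polyC_leq1 size_poly0 expr0n addr0 -rmorphXn /= sqr_sqrtr.
have [sa1|sa1] := leqP (size a) 1.
  have [|u [v [su sv aE]]] := IH a a0; first exact: leq_trans sa1 _.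
  by exists u, v; split=> //; exact: leqW.
have [s [t /dvdpP[q aE]]] := quadratic_factor a0 sa1.
set D := _ + _ in aE.
have DE x : D.[x] = (x - s) ^+ 2 + t ^+ 2 by rewrite /D !hornerE.
have q0 x : 0 <= q.[x].
  (* only at y = s, and only if t = 0, can the factor D vanish *)
  have qge0 y : y != s -> 0 <= q.[y].
    rewrite -subr_eq0 => ys; have := a0 y; rewrite aE hornerM DE.
    by rewrite pmulr_lge0// ltr_pwDl ?sqr_ge0// lt_neqAle sqr_ge0 andbT eq_sym sqrf_eq0.
  have [->|/qge0//] := eqVneq x s.
  by apply: horner_right_ge0 => y sy; apply: qge0; rewrite gt_eqF.
have [qz|qn0] := eqVneq q 0.
  by move: sa1; rewrite aE qz mul0r size_poly0.
have sD : size D = 3%N.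
  by rewrite /D size_polyDl size_exp_XsubC// size_polyC; case: eqP.
have [|u [v [su sv qE]]] := IH q q0.
  by move: sa; rewrite aE size_mul// -?size_poly_eq0 ?sD// addn3 doubleS /= !ltnS.
exists (u * ('X - s%:P) - v * t%:P), (v * ('X - s%:P) + u * t%:P).
have sX (c : R) (w : {poly R}) : (size w <= k.+1)%N -> (size (w * ('X - c%:P))%R <= k.+2)%N.
  by move=> sw; rewrite (leq_trans (size_polyMleq _ _))// size_XsubC; lia.
have sC (c : R) (w : {poly R}) : (size w <= k.+1)%N -> (size (w * c%:P)%R <= k.+2)%N.
  move=> sw; rewrite (leq_trans (size_polyMleq _ _))// size_polyC.
  by case: (c != 0); lia.
split.
- by rewrite (leq_trans (size_polyD _ _))// size_polyN geq_max sX// sC.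
- by rewrite (leq_trans (size_polyD _ _))// geq_max sX// sC.
- by rewrite aE qE /D rmorphXn /=; ring.
Qed.

(** Rotating (u, v) preserves u^2 + v^2; the rotation moving (u(0), v(0)) onto the
    positive axis makes the values at 0 depend on a(0) only. *)
Lemma nonneg_sum_two_squares_at0 k a : (forall x, 0 <= a.[x]) ->
  (size a <= k.*2.+1)%N ->
  exists u v, [/\ (size u <= k.+1)%N, (size v <= k.+1)%N, a = u ^+ 2 + v ^+ 2,
    u.[0] = Num.sqrt a.[0] & v.[0] = 0].
Proof.
move=> a0 /(nonneg_sum_two_squares a0)[u [v [su sv aE]]].
have a00 : a.[0] = u.[0] ^+ 2 + v.[0] ^+ 2 by rewrite aE !hornerE.
pose c := Num.sqrt a.[0].
have c2 : c ^+ 2 = u.[0] ^+ 2 + v.[0] ^+ 2 by rewrite sqr_sqrtr.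
have [c0|cn0] := eqVneq c 0.
  exists u, v; rewrite -/c c0; move: c2; rewrite c0 expr0n /= => /esym/eqP.
  rewrite paddr_eq0 ?sqr_ge0// !sqrf_eq0 => /andP[/eqP u0 /eqP v0].
  by split.
exists ((u.[0] / c) *: u + (v.[0] / c) *: v), ((u.[0] / c) *: v - (v.[0] / c) *: u).
split.
- by rewrite (leq_trans (size_polyD _ _))// geq_max !(leq_trans (size_scale_leq _ _)).
- by rewrite (leq_trans (size_polyD _ _))// size_polyN geq_max !(leq_trans (size_scale_leq _ _)).
- rewrite aE -!mul_polyC.
  have : ((u.[0] / c) ^+ 2 + (v.[0] / c) ^+ 2)%:P = 1 :> {poly R}.
    rewrite !expr_div_n -mulrDl -c2 divff ?expf_neq0//.
  rewrite rmorphD !rmorphXn /= => e1.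
  transitivity (((u.[0] / c)%:P ^+ 2 + (v.[0] / c)%:P ^+ 2) * (u ^+ 2 + v ^+ 2)).
    by rewrite e1 mul1r.
  ring.
- rewrite !hornerE -/c; apply: (mulfI cn0); rewrite -expr2 c2.
  by field.
- by rewrite !hornerE; ring.
Qed.

End SumsOfSquares.

(** * Polynomials restricted to the line and the curve *)

Section Curve.
Context {R : realType}.
Implicit Types (f g : mpoly 2 R) (a b q : {poly R}) (l : nat).

Definition subst_monomials (e : nat -> multinom 2) q : mpoly 2 R :=
  \sum_(i < size q) q`_i *: mpolyX R (e i).

Lemma subst_monomialsE e k q : (size q <= k)%N ->
  subst_monomials e q = \sum_(i < k) q`_i *: mpolyX R (e i).
Proof.
move=> qk; rewrite /subst_monomials (big_ord_widen k (fun i => q`_i *: mpolyX R (e i)))//.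
rewrite big_mkcond; apply: eq_bigr => i _; case: ltnP => // qi.
by rewrite nth_default// scale0r.
Qed.

Lemma subst_monomials_is_linear e : linear (subst_monomials e).
Proof.
move=> c p q; pose k := maxn (size p) (size q).
rewrite !(@subst_monomialsE e k) ?leq_maxl ?leq_maxr//; last first.
  rewrite (leq_trans (size_polyD _ _))// geq_max.
  by rewrite (leq_trans (size_scale_leq _ _)) ?leq_maxl ?leq_maxr.
rewrite scaler_sumr -big_split; apply: eq_bigr => i _ /=.
by rewrite coefD coefZ scalerDl scalerA.
Qed.

HB.instance Definition _ e := GRing.isLinear.Build R {poly R} (mpoly 2 R) _
  (subst_monomials e) (subst_monomials_is_linear e).

Lemma subst_monomialsXn e k : subst_monomials e 'X^k = mpolyX R (e k).
Proof.
rewrite (@subst_monomialsE e k.+1) ?size_polyXn// (bigD1 ord_max)//=.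
rewrite coefXn eqxx scale1r big1 ?addr0// => i ik.
by rewrite coefXn (negbTE (_ : val i != k)) ?scale0r.
Qed.

Lemma msize_subst_monomials e q d :
  (forall i, (i < size q)%N -> (mdeg (e i) <= d)%N) ->
  (msize (subst_monomials e q) <= d.+1)%N.
Proof.
move=> ed; apply: leq_trans (msize_sum _ _ _) _; apply/bigmax_leqP_seq => i _ _.
by apply: leq_trans (msizeZ_le _ _) _; rewrite msizeX ltnS ed.
Qed.

Definition on_line f : {poly R} :=
  mmap (polyC : R -> {poly R}) (fun i : 'I_2 => if i == 0 then 'X else 0) f.

Definition on_curve l f : {poly R} :=
  mmap (polyC : R -> {poly R}) (fun i : 'I_2 => if i == 0 then 'X^l else 'X) f.

HB.instance Definition _ := GRing.RMorphism.copy on_line on_line.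
HB.instance Definition _ l := GRing.RMorphism.copy (on_curve l) (on_curve l).

Lemma on_lineZ c f : on_line (c *: f) = c *: on_line f.
Proof. by rewrite /on_line mmapZ mul_polyC. Qed.

Lemma on_curveZ l c f : on_curve l (c *: f) = c *: on_curve l f.
Proof. by rewrite /on_curve mmapZ mul_polyC. Qed.

HB.instance Definition _ :=
  GRing.isScalable.Build R (mpoly 2 R) {poly R} *:%R on_line on_lineZ.
HB.instance Definition _ l :=
  GRing.isScalable.Build R (mpoly 2 R) {poly R} *:%R (on_curve l) (@on_curveZ l).

Lemma on_lineX i j : on_line (mpolyX R (mon i j)) = 'X^i * (j == 0%N)%:R.
Proof.
rewrite /on_line mmapX /mmap1 big_ord_recl big_ord1 /= mon0.
by rewrite (_ : lift _ _ = 1) ?mon1 ?expr0n//; exact/val_inj.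
Qed.

Lemma on_curveX l i j : on_curve l (mpolyX R (mon i j)) = 'X^(l * i + j).
Proof.
rewrite /on_curve mmapX /mmap1 big_ord_recl big_ord1 /= mon0.
by rewrite (_ : lift _ _ = 1) ?mon1 -?exprM ?exprD//; exact/val_inj.
Qed.

Lemma horner_on_line f t : (on_line f).[t] = eval_at f (t, 0).
Proof.
rewrite {1 2}[f]mpolyE raddf_sum horner_sum /eval_at raddf_sum /=.
apply: eq_bigr => m _; rewrite linearZ hornerZ mevalZ /=; congr (_ * _).
rewrite -/(eval_at _ (t, 0)) (monE m) on_lineX eval_atX mon0 mon1 /= expr0n.
by rewrite hornerM hornerXn; case: eqP => _; rewrite hornerE.
Qed.

Lemma horner_on_curve l f t : (on_curve l f).[t] = eval_at f (t ^+ l, t).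
Proof.
rewrite {1 2}[f]mpolyE raddf_sum horner_sum /eval_at raddf_sum /=.
apply: eq_bigr => m _; rewrite linearZ hornerZ mevalZ /=; congr (_ * _).
rewrite -/(eval_at _ (t ^+ l, t)) (monE m) on_curveX eval_atX mon0 mon1 /=.
by rewrite hornerXn exprD exprM.
Qed.

(** Among the monomials divisible by y, so vanishing on the line y = 0, one of
    lowest degree that restricts to y^k on the curve x = y^l, for k > 0.  For
    k = 0 any monomial divisible by y would do, as its coefficient in
    [curve_lift] is 0 when a and b agree at the intersection point. *)
Definition canon l k := mon (k.-1 %/ l) (k.-1 %% l).+1.

(** A section of the restriction to the line y = 0 and the curve x = y^l, for
    pairs (a, b) that agree at the intersection point. *)
Definition curve_lift l a b : mpoly 2 R :=
  subst_monomials (mon^~ 0%N) a + subst_monomials (canon l) (b - (a \Po 'X^l)).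

Definition normal_form l f := curve_lift l (on_line f) (on_curve l f).

Lemma normal_form_is_linear l : linear (normal_form l).
Proof.
move=> c f g; rewrite /normal_form [on_line (_ + _)]linearP.
rewrite [on_curve _ (_ + _)]linearP /curve_lift /=.
move: (on_line f) (on_line g) (on_curve l f) (on_curve l g) => a a' b b'.
rewrite [X in _ - X]linearP [in LHS]linearP /=.
have -> : c *: b + b' - (c *: (a \Po 'X^l) + (a' \Po 'X^l)) =
    c *: (b - (a \Po 'X^l)) + (b' - (a' \Po 'X^l)).
  by rewrite scalerBr opprD addrACA.
by rewrite linearP scalerDr addrACA.
Qed.

HB.instance Definition _ l := GRing.isLinear.Build R (mpoly 2 R) (mpoly 2 R) _
  (normal_form l) (normal_form_is_linear l).

Lemma on_line_curve_lift l a b : on_line (curve_lift l a b) = a.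
Proof.
rewrite /curve_lift raddfD /= /subst_monomials !raddf_sum /= [X in _ + X]big1 => [|i _].
  rewrite addr0 -[RHS]coefK poly_def; apply: eq_bigr => i _.
  by rewrite linearZ /= on_lineX mulr1.
by rewrite linearZ /= on_lineX mulr0 scaler0.
Qed.

Lemma on_curve_curve_lift l a b : a.[0] = b.[0] -> (0 < l)%N ->
  on_curve l (curve_lift l a b) = b.
Proof.
move=> ab l0; rewrite /curve_lift raddfD /= -[RHS](addrNK (a \Po 'X^l) b) addrC.
rewrite /subst_monomials !raddf_sum /=; congr (_ + _).
  rewrite -[RHS]coefK poly_def; apply: eq_bigr => -[[|k] kq] _ /=.
    rewrite -horner_coef0 hornerD hornerN horner_comp hornerXn expr0n gtn_eqF//.
    by rewrite ab subrr !scale0r linear0.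
  by rewrite linearZ /= on_curveX /= addnS mulnC -divn_eq.
rewrite comp_polyE; apply: eq_bigr => i _.
by rewrite linearZ /= on_curveX addn0 exprM.
Qed.

(** A polynomial of degree l (n + 1) in y costs only degree n + l, since y^l is
    traded for x as long as a factor y remains. *)
Lemma msize_curve_lift l n a b : (0 < l)%N ->
  (size a <= n.+2)%N -> (size b <= (l * n.+1).+1)%N ->
  (msize (curve_lift l a b) <= (n + l).+1)%N.
Proof.
move=> l0 sa sb; apply: leq_trans (msizeD_le _ _) _; rewrite geq_max.
apply/andP; split; apply: msize_subst_monomials => i.
  by rewrite mdeg_mon addn0; lia.
move=> ic; rewrite mdeg_mon addnS.
have il : (i <= l * n.+1)%N.
  rewrite -ltnS (leq_trans ic)// (leq_trans (size_polyD _ _))// size_polyN geq_max sb.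
  rewrite (leq_trans (size_comp_poly_leq _ _))// ltnS size_polyXn /= mulnC leq_mul//.
  by case: (size a) sa.
have im := ltn_pmod i.-1 l0.
have : (i.-1 %/ l <= n)%N.
  rewrite -ltnS ltn_divLR// mulnC; case: i il {ic im} => //=.
  by rewrite muln_gt0 l0.
lia.
Qed.

Lemma msizeM_bound f g d d' : (msize f <= d.+1)%N -> (msize g <= d'.+1)%N ->
  (msize (f * g) <= (d + d').+1)%N.
Proof.
have [->|f0] := eqVneq f 0; first by rewrite mul0r msize0.
have [->|g0] := eqVneq g 0; first by rewrite mulr0 msize0.
rewrite msizeM_proper ?mulf_neq0 ?mleadc_eq0//; lia.
Qed.

Section Reduction.
Context (L : {linear mpoly 2 R -> R^o}) (l d : nat).
Hypothesis l_gt0 : (0 < l)%N.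
Hypothesis L_curve : forall i j, (i + (j + l).+1 <= d)%N ->
  L (mpolyX R (mon i.+1 j.+1)) = L (mpolyX R (mon i (j + l).+1)).

Lemma L_canon i j : (i + j.+1 <= d)%N ->
  L (mpolyX R (mon i j.+1)) = L (mpolyX R (canon l (l * i + j.+1))).
Proof.
move=> ij; rewrite /canon addnS /= mulnC divnMDl// modnMDl.
have step k : (k <= j %/ l)%N -> L (mpolyX R (mon i j.+1)) =
    L (mpolyX R (mon (i + k) (j - k * l).+1)).
  elim: k => [|k IH] kj; first by rewrite addn0 mul0n subn0.
  have klj : (k.+1 * l <= j)%N by rewrite -leq_divRL.
  rewrite IH ?(ltnW kj)// addnS (L_curve (i := i + k) (j := j - k.+1 * l)).
    by do 4!f_equal; lia.
  by nia.
rewrite (step _ (leqnn _)); do 4!f_equal.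
by rewrite {1}(divn_eq j l) addKn.
Qed.

(** In the range of degrees where L vanishes on the multiples of y (x - y^l), it
    depends only on the restrictions to the two components. *)
Lemma L_normal_form f : (msize f <= d.+1)%N -> L f = L (normal_form l f).
Proof.
move=> fd; rewrite (mpolywE fd) !raddf_sum; apply: eq_bigr => m _.
rewrite /= !linearZ /=; congr (_ * _).
have := bmdeg m; rewrite ltnS (monE m) mdeg_mon.
move: (bmnm m 0) (bmnm m 1) => i [|j] ij.
  rewrite /normal_form /curve_lift on_lineX on_curveX mulr1 addn0 comp_Xn_poly -exprM.
  by rewrite subrr linear0 addr0 subst_monomialsXn.
rewrite /normal_form /curve_lift on_lineX on_curveX mulr0 comp_poly0 subr0.
by rewrite linear0 add0r subst_monomialsXn -L_canon.
Qed.

End Reduction.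
End Curve.

(** * Measures and cones of point evaluations *)

Section PointFunctionals.
Context {R : realType} {d : nat}.
Implicit Types (z : R * R) (f : 'cV[R]_#|monomials d|).

Lemma pair_evals_of_coefs z f : pair (evals d z) f = eval_at (of_coefs f) z.
Proof.
rewrite pairE /of_coefs /eval_at raddf_sum /=; apply: eq_bigr => i _.
by rewrite mxE mevalZ mulrC.
Qed.

Lemma pair_evalsE z f : pair (evals d z) f =
  \sum_i f i 0 * (z.1 ^+ (enum_val i : monomials d) 0 * z.2 ^+ (enum_val i : monomials d) 1).
Proof. by rewrite pairE; apply: eq_bigr => i _; rewrite mxE eval_atX mulrC. Qed.

Lemma continuous_pair_evals f : continuous (fun z => pair (evals d z) f).
Proof.
under eq_fun do rewrite pair_evalsE.
apply: continuous_big => [|i _ z]; first exact: add_continuous.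
apply: cvgM; first exact: cvg_cst.
apply: cvgM.
  apply: (@continuous_comp _ _ _ fst (fun x : R => x ^+ _)); first exact: cvg_fst.
  exact: exprn_continuous.
apply: (@continuous_comp _ _ _ snd (fun x : R => x ^+ _)); first exact: cvg_snd.
exact: exprn_continuous.
Qed.

Definition monomial_fun (m : multinom 2) z : R := z.1 ^+ m 0 * z.2 ^+ m 1.

Lemma measurable_monomial_fun m : measurable_fun [set: R * R] (monomial_fun m).
Proof.
by apply: measurable_funM; apply: measurable_funX.
Qed.

Lemma measurable_pair_evals f : measurable_fun [set: R * R] (fun z => pair (evals d z) f).
Proof.
under eq_fun do rewrite pair_evalsE.
apply: measurable_sum => i; apply: measurable_funM => //.
exact: measurable_monomial_fun.
Qed.

End PointFunctionals.

Section Measures.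
Context {R : realType}.
Implicit Types (z : R * R) (mu : {measure set (R * R) -> \bar R}).

Local Open Scope ereal_scope.

Lemma integral_mscale_dirac (c : {nonneg R}) z (f : R * R -> R) :
  measurable_fun [set: R * R] f ->
  (mscale c \d_z).-integrable [set: R * R] (EFin \o f) /\
  \int[mscale c \d_z]_x (f x)%:E = (c%:num * f z)%:E.
Proof.
move=> mf; have mEf : measurable_fun [set: R * R] (EFin \o f) by exact/measurable_EFinP.
have ge0E (g : R * R -> \bar R) : measurable_fun [set: R * R] g -> (forall x, 0 <= g x) ->
    \int[mscale c \d_z]_x g x = c%:num%:E * g z.
  by move=> mg g0; rewrite ge0_integral_mscale// integral_dirac// diracT mul1e.
split.
  apply/integrableP; split => //; rewrite ge0E//; last exact: measurableT_comp.
  by rewrite /= ltry.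
rewrite integralE !ge0E//; [|exact: measurable_funeneg|exact: measurable_funepos].
have fz : (f z = Num.max (f z) 0 - Num.max (- f z) 0)%R.
  have [f0|/ltW f0] := leP 0%R (f z).
    by rewrite max_r ?oppr_le0// subr0.
  by rewrite max_l ?oppr_ge0// sub0r opprK.
rewrite funeposE funenegE /= -!EFin_max -!EFinM -EFinB -mulrBr.
by rewrite -fz.
Qed.

Lemma cone_measure d (X : set (R * R)) (v : 'rV[R]_#|monomials d|) :
  cone (evals d) X v ->
  exists mu, mu (~` X) = 0 /\ forall m : monomials d,
    mu.-integrable [set: R * R] (EFin \o monomial_fun m) /\
    \int[mu]_z (monomial_fun m z)%:E = (v 0%R (enum_rank m))%:E.
Proof.
elim=> [|c z {}v c0 Xz _ [mu [muX mum]]].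
  exists mzero; split=> // m; rewrite integral_measure_zero mxE; split=> //.
  apply/integrableP; split; last by rewrite integral_measure_zero ltry.
  by apply/measurable_EFinP; exact: measurable_monomial_fun.
exists (measure_add (mscale (NngNum c0) \d_z) mu); split.
  rewrite [LHS]measure_addE muX adde0 -[LHS]/(c%:E * \d_z (~` X)).
  by rewrite diracE memNset ?mule0// => /(_ Xz).
move=> m; have [mui muE] := mum m.
have [di dE] := integral_mscale_dirac (NngNum c0) z (measurable_monomial_fun m).
have mw : measurable_fun [set: R * R] (EFin \o monomial_fun m).
  by apply/measurable_EFinP; exact: measurable_monomial_fun.
split.
  apply/integrableP; split => //.
  rewrite ge0_integral_measure_add//; last exact: measurableT_comp.
  by rewrite lte_add_pinfty//; [case/integrableP : di|case/integrableP : mui].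
rewrite (integral_measure_add measurableT di mui)// dE muE /= -EFinD !mxE.
by rewrite /monomial enum_rankK eval_atX.
Qed.

(** Richter's theorem: the moments of a measure on X are those of finitely many
    atoms in X.  The sets of full measure are good for
    [cone_of_facial_positivity], as a nonnegative function of zero integral
    vanishes almost everywhere. *)
Lemma measure_cone d (X : set (R * R)) mu (v : 'rV[R]_#|monomials d|) :
  measurable X -> mu (~` X) = 0 ->
  (forall m : monomials d,
    mu.-integrable [set: R * R] (EFin \o monomial_fun m) /\
    \int[mu]_z (monomial_fun m z)%:E = (v 0%R (enum_rank m))%:E) ->
  cone (evals d) X v.
Proof.
move=> mX muX mum.
pose Good (Y : set (R * R)) := measurable Y /\ mu (~` Y) = 0.
apply: (@cone_of_facial_positivity _ _ _ _ Good) => // Y [mY muY] f f0.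
pose F z := pair (evals d z) f.
have Fw : (fun z => (F z)%:E) =
    fun z => \sum_i (f i 0%R)%:E * (monomial_fun (enum_val i : monomials d) z)%:E.
  by apply/funext => z; rewrite /F pair_evalsE -sumEFin.
have Fi : mu.-integrable [set: R * R] (fun z => (F z)%:E).
  rewrite Fw.
  apply: (integrable_sum measurableT) => i _; apply: (integrableZl measurableT).
  by have [] := mum (enum_val i).
have FE : \int[mu]_z (F z)%:E = (pair v f)%:E.
  rewrite Fw integral_sum//; last first.
    by move=> i; apply: (integrableZl measurableT); have [] := mum (enum_val i).
  rewrite pairE -sumEFin; apply: eq_bigr => i _.
  have [mi mE] := mum (enum_val i).
  by rewrite integralZl// mE enum_valK -EFinM mulrC.
have FY : \int[mu]_(z in Y) (F z)%:E = (pair v f)%:E.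
  rewrite -FE (negligible_integral (measurableC mY) measurableT Fi muY).
  by rewrite setTD setCK.
split.
  by rewrite -lee_fin -FY; apply: integral_ge0 => z Yz; rewrite lee_fin f0.
move=> vf0.
have mYF : measurable (Y `&` [set z | pair (evals d z) f = 0%R]).
  apply: measurableI => //; rewrite -[X in measurable X]setTI.
  have := measurable_pair_evals f; move=> mp.
  exact: (mp measurableT [set 0%R] (measurable_set1 0%R)).
split=> //.
have FY0 : \int[mu]_(z in Y) `|(F z)%:E| = 0.
  rewrite -[RHS]/(0%R%:E) -vf0 -FY; apply: eq_integral => z Yz'; have Yz := set_mem Yz'.
  by rewrite gee0_abs// lee_fin; exact: f0.
have mEF : measurable_fun Y (EFin \o F).
  apply: measurable_funTS; apply/measurable_EFinP.
  exact: measurable_pair_evals.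
have /(ae_eq_integral_abs mu mY mEF)[N [mN muN YFN]] := FY0.
apply: (@subset_measure0 _ _ _ _ _ (~` Y `|` N)).
- exact: measurableC.
- by apply: measurableU => //; exact: measurableC.
- move=> z; rewrite setCI => -[NYz|Fz]; first by left.
  have [Yz|] := pselect (Y z); last by left.
  by right; apply: YFN => /= /(_ Yz)[].
- by apply: null_set_setU => //; exact: measurableC.
Qed.

End Measures.

(** * Positivity up to a perturbation of higher degree *)

Section Haviland.
Context {R : realType}.
Implicit Types (z : R * R) (X : set (R * R)).

(** On the compact set where g <= 0 the function f is bounded below by a positive
    constant, so a large multiple of f compensates for g. *)
Lemma compact_penalty X (f g : R * R -> R) r : closed X ->
  continuous f -> continuous g ->
  (forall z, X z -> 0 <= f z) ->
  (forall z, X z -> f z = 0 -> 0 < g z) ->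
  (forall z, X z -> g z <= 0 -> `|z.1| <= r /\ `|z.2| <= r) ->
  exists C, 0 <= C /\ forall z, X z -> 0 <= g z + C * f z.
Proof.
move=> clX cf cg f0 g0 gr.
pose D := X `&` [set z | g z <= 0].
have clD : closed D.
  apply: closedI => //; apply: (preimage_closed (f := g) (D := [set x | x <= 0])).
    by move=> z _; exact: cg.
  exact: closed_le.
have cD : compact D.
  apply: (@subclosed_compact _ D (`[- r, r] `*` `[- r, r])%classic) => //.
    by apply: compact_setX; exact: segment_compact.
  move=> z [Xz gz]; have [z1 z2] := gr z Xz gz.
  by split; rewrite /= in_itv /= -ler_norml.
have [D0|D0] := pselect (D !=set0); last first.
  exists 0; split=> // z Xz; rewrite mul0r addr0 leNgt; apply/negP => gz.
  by apply: D0; exists z; split=> //; exact: ltW.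
have [y /set_mem[Xy gy] fy] := compact_EVT_min D0 cD (continuous_subspaceT cf).
have [w /set_mem[Xw gw] minw] := compact_EVT_min D0 cD (continuous_subspaceT cg).
have fy0 : 0 < f y.
  by rewrite lt_neqAle f0// andbT eq_sym; apply/eqP => /(g0 _ Xy); rewrite ltNge gy.
exists (- g w / f y); split; first by rewrite divr_ge0 ?oppr_ge0// ltW.
move=> z Xz; have [gz|gz] := leP (g z) 0; last first.
  by rewrite addr_ge0 ?(ltW gz)// mulr_ge0 ?f0// divr_ge0 ?oppr_ge0// ltW.
have Dz : z \in D by rewrite inE.
have := minw z Dz; have := fy z Dz => fyz gwz.
suff : - g w <= - g w / f y * f z by lra.
by rewrite -[leLHS](divfK (lt0r_neq0 fy0)) ler_wpM2l// divr_ge0 ?oppr_ge0// ltW.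
Qed.

Definition growth n z : R := 1 + z.1 ^+ n.+1.*2 + z.2 ^+ n.+1.*2.

Lemma growth_gt0 n z : 0 < growth n z.
Proof. by rewrite /growth -addrA ltr_pwDl// addr_ge0 // exprn_even_ge0// odd_double. Qed.

Lemma continuous_growth n : continuous (growth n).
Proof.
move=> z; apply: cvgD; first apply: cvgD; first exact: cvg_cst.
  apply: (@continuous_comp _ _ _ fst (fun x : R => x ^+ _)); first exact: cvg_fst.
  exact: exprn_continuous.
apply: (@continuous_comp _ _ _ snd (fun x : R => x ^+ _)); first exact: cvg_snd.
exact: exprn_continuous.
Qed.

Lemma growth_dominates n (f : 'cV[R]_#|monomials (2 * n)|) e : 0 < e ->
  exists r, forall z, pair (evals _ z) f + e * growth n z <= 0 ->
    `|z.1| <= r /\ `|z.2| <= r.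
Proof.
move=> e0; pose A := \sum_i `|f i 0|.
have A0 : 0 <= A by apply: sumr_ge0.
exists (1 + A / e) => -[x y] /= fz.
pose M := Num.max 1 (Num.max `|x| `|y|).
have M1 : 1 <= M by rewrite le_max lexx.
have Mx : `|x| <= M by rewrite !le_max lexx orbT.
have My : `|y| <= M by rewrite !le_max lexx !orbT.
suff Mr : M <= 1 + A / e by split; [exact: le_trans Mx Mr | exact: le_trans My Mr].
have M0 : 0 < M by lra.
have fM : `|pair (evals (2 * n) (x, y)) f| <= A * M ^+ (2 * n).
  rewrite pair_evalsE mulr_suml (le_trans (ler_norm_sum _ _ _))//.
  apply: ler_sum => i _; rewrite normrM ler_wpM2l//= normrM !normrX.
  set m := bmnm (enum_val i).
  have mn : (m 0%R + m 1%R <= 2 * n)%N.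
    by rewrite -mdeg_mon -monE -ltnS; exact: (bmdeg (enum_val i : monomials _)).
  apply: (@le_trans _ _ (M ^+ (m 0%R + m 1%R))).
    by rewrite exprD ler_pM ?exprn_ge0// lerXn2r// nnegrE ltW.
  by rewrite ler_weXn2l.
have bM : M ^+ n.+1.*2 <= growth n (x, y).
  have evenX (t : R) : t ^+ n.+1.*2 = `|t| ^+ n.+1.*2.
    by rewrite -normrX ger0_norm// exprn_even_ge0// odd_double.
  have X0 (t : R) : 0 <= `|t| ^+ n.+1.*2 by rewrite exprn_ge0.
  rewrite /growth /= (evenX x) (evenX y).
  have := X0 x; have := X0 y.
  rewrite /M /Num.max; case: ifP => _; last by rewrite expr1n; lra.
  by case: ifP => _; lra.
have : e * M ^+ n.+1.*2 <= A * M ^+ (2 * n).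
  move: fM bM; rewrite ler_norml => /andP[fM _] bM.
  have := ler_wpM2l (ltW e0) bM; lra.
rewrite doubleS -mul2n -addn2 exprD mulrCA mulrC ler_pM2r ?exprn_gt0// => eM.
have MA : M ^+ 2 <= A / e by rewrite ler_pdivlMr// mulrC.
rewrite (le_trans (_ : M <= M ^+ 2))//; first by rewrite expr2 ler_peMl// ltW.
by lra.
Qed.

(** The truncated form of Haviland's theorem.  The number h plays the part of the
    value at w = [growth n] of an extension of v.  The cone of X need not be
    closed, and positivity of v alone on X would not suffice: mass could escape to
    infinity.  The class of closed sets X satisfying the hypothesis is stable
    under passing to the zeros of an f >= 0 with [pair v f = 0].  Indeed, if
    g + e w >= 0 at these zeros and e' > e, then g + e' w is positive there, and
    positive far away because w has the higher degree; so g + e' w + C f >= 0 on X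
    for C large, where f contributes nothing to v, and e' tends to e. *)
Lemma cone_of_perturbed_positivity n X (v : 'rV[R]_#|monomials (2 * n)|) h :
  closed X ->
  (forall (f : 'cV_#|monomials (2 * n)|) e, 0 < e ->
    (forall z, X z -> 0 <= pair (evals _ z) f + e * growth n z) ->
    0 <= pair v f + e * h) ->
  cone (evals (2 * n)) X v.
Proof.
move=> clX Xpos.
pose Good Y := closed Y /\
  forall (f : 'cV_#|monomials (2 * n)|) e, 0 < e ->
    (forall z, Y z -> 0 <= pair (evals _ z) f + e * growth n z) ->
    0 <= pair v f + e * h.
apply: (@cone_of_facial_positivity _ _ _ _ Good); last by split.
move=> Y [clY Ypos] f f0.
(* an affine function of e, nonnegative for e > e0, is nonnegative at e0 *)
have lim_ge0 (a b e0 : R) : (forall e, e0 < e -> 0 <= a + e * b) -> 0 <= a + e0 * b.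
  move=> ab; rewrite leNgt; apply/negP => c0.
  have := ab (e0 + - (a + e0 * b) / (2 * (1 + `|b|))).
  have b1 : 0 < 2 * (1 + `|b|) by have := normr_ge0 b; lra.
  have q0 : 0 < - (a + e0 * b) / (2 * (1 + `|b|)) by rewrite divr_gt0// oppr_gt0.
  rewrite ltrDl q0 => /(_ isT); set q := _ / _.
  have qE : q * (2 * (1 + `|b|)) = - (a + e0 * b) by rewrite divfK// gt_eqF.
  have := ler_norm b; have := normr_ge0 b; nra.
split.
  have -> : pair v f = pair v f + 0 * h by rewrite mul0r addr0.
  apply: lim_ge0 => e e0; apply: Ypos => // z Yz.
  by rewrite addr_ge0 ?f0// mulr_ge0 ?ltW// growth_gt0.
move=> vf; split.
  apply: closedI => //.
  apply: (preimage_closed (f := fun z => pair (evals _ z) f) (D := [set x | x = 0])).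
    by move=> z _; exact: continuous_pair_evals.
  exact: closed_eq.
move=> g e e0 g0; apply: lim_ge0 => e' ee'.
have [r gr] := @growth_dominates n g e' (lt_trans e0 ee').
have [||C [C0 gC]] := @compact_penalty Y (fun z => pair (evals _ z) f)
    (fun z => pair (evals _ z) g + e' * growth n z) r clY
    (@continuous_pair_evals _ _ f) _ f0 _ (fun z _ => gr z).
- move=> z; apply: cvgD; first exact: continuous_pair_evals.
  by apply: cvgM; [exact: cvg_cst | exact: continuous_growth].
- move=> z Yz fz; have := g0 z (conj Yz fz); have := growth_gt0 n z; nra.
have -> : pair v g = pair v (g + C *: f) by rewrite pairDr pairZr vf mulr0 addr0.
apply: Ypos => [|z Yz]; first exact: lt_trans ee'.
by rewrite pairDr pairZr addrAC gC.
Qed.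

End Haviland.

(** * The functional of an extension on the two components *)

Section CurvePositivity.
Context {R : realType}.

Lemma size_on_line (f : mpoly 2 R) D : (msize f <= D.+1)%N ->
  (size (on_line f) <= D.+1)%N.
Proof.
move=> fD; rewrite (mpolywE fD) raddf_sum; apply: (leq_trans (size_sum _ _ _)).
apply/bigmax_leqP => m _; rewrite /= linearZ (leq_trans (size_scale_leq _ _))//=.
have := bmdeg m; rewrite (monE m) mdeg_mon on_lineX; move: (bmnm m 0) (bmnm m 1) => i [|j] ij.
  by rewrite mulr1 size_polyXn; lia.
by rewrite mulr0 size_poly0.
Qed.

Lemma size_on_curve l (f : mpoly 2 R) D : (0 < l)%N -> (msize f <= D.+1)%N ->
  (size (on_curve l f) <= (l * D).+1)%N.
Proof.
move=> l0 fD; rewrite (mpolywE fD) raddf_sum; apply: (leq_trans (size_sum _ _ _)).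
apply/bigmax_leqP => m _; rewrite /= linearZ (leq_trans (size_scale_leq _ _))//=.
have := bmdeg m; rewrite (monE m) mdeg_mon on_curveX.
move: (bmnm m 0) (bmnm m 1) => i j ij; rewrite size_polyXn; nia.
Qed.

(** The restrictions of f to the two components are nonnegative, hence sums of two
    squares u^2 + v^2 and u'^2 + v'^2 with u, u' and v, v' agreeing at the
    intersection point.  The pairs (u, u') and (v, v') then glue to polynomials
    g1, g2 of degree at most n + l, and f = g1^2 + g2^2 on both components. *)
Lemma positive_on_curve (L : {linear mpoly 2 R -> R^o}) l n (f : mpoly 2 R) :
  (0 < l)%N ->
  (forall g, (msize g <= (n + l).+1)%N -> 0 <= L (g * g)) ->
  (forall i j, (i + (j + l).+1 <= 2 * (n + l))%N ->
    L (mpolyX R (mon i.+1 j.+1)) = L (mpolyX R (mon i (j + l).+1))) ->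
  (msize f <= (n.+1.*2).+1)%N ->
  (forall t, 0 <= eval_at f (t, 0)) -> (forall t, 0 <= eval_at f (t ^+ l, t)) ->
  0 <= L f.
Proof.
move=> l0 Lsq Lcurve fn f_line f_curve.
have a0 t : 0 <= (on_line f).[t] by rewrite horner_on_line.
have b0 t : 0 <= (on_curve l f).[t] by rewrite horner_on_curve.
have ab : (on_line f).[0] = (on_curve l f).[0].
  by rewrite horner_on_line horner_on_curve expr0n gtn_eqF.
have [u [v [su sv aE u0 v0]]] := nonneg_sum_two_squares_at0 a0 (size_on_line fn).
have [|u' [v' [su' sv' bE u'0 v'0]]] := @nonneg_sum_two_squares_at0 _ (l * n.+1) _ b0.
  by apply: leq_trans (size_on_curve l0 fn) _; rewrite -!muln2 mulnA.
have uu' : u.[0] = u'.[0] by rewrite u0 u'0 ab.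
have vv' : v.[0] = v'.[0] by rewrite v0 v'0.
pose g1 := curve_lift l u u'; pose g2 := curve_lift l v v'.
have sg1 : (msize g1 <= (n + l).+1)%N by exact: msize_curve_lift.
have sg2 : (msize g2 <= (n + l).+1)%N by exact: msize_curve_lift.
have sgg (g : mpoly 2 R) : (msize g <= (n + l).+1)%N ->
    (msize (g * g) <= (2 * (n + l)).+1)%N.
  by move=> sg; rewrite mul2n -addnn msizeM_bound.
have -> : L f = L (g1 * g1 + g2 * g2).
  rewrite (L_normal_form l0 Lcurve); last by apply: leq_trans fn _; lia.
  rewrite [RHS](L_normal_form l0 Lcurve); last first.
    by apply: leq_trans (msizeD_le _ _) _; rewrite geq_max !sgg.
  rewrite /normal_form !rmorphD !rmorphM /= !on_line_curve_lift !on_curve_curve_lift//.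
  by rewrite aE bE !expr2.
by rewrite linearD /= addr_ge0// Lsq.
Qed.

Definition curve_poly l : mpoly 2 R := varY * (varX - varY ^+ l).

Lemma curve_polyE l : curve_poly l = mpolyX R (mon 1 1) - mpolyX R (mon 0 l.+1).
Proof. by rewrite /curve_poly !monX mulrBr expr0 mul1r !expr1 exprS mulrC. Qed.

Lemma curve_polyX l i j : curve_poly l * mpolyX R (mon i j) =
  mpolyX R (mon i.+1 j.+1) - mpolyX R (mon i (j + l).+1).
Proof. by rewrite curve_polyE mulrBl -!mpolyXD !monD !add1n add0n addSn addnC. Qed.

Lemma eval_curve_poly l z : eval_at (curve_poly l) z = z.2 * (z.1 - z.2 ^+ l).
Proof.
rewrite curve_polyE /eval_at mevalB -!/(eval_at _ z) !eval_atX !mon0 !mon1.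
by rewrite !expr1 expr0 mul1r exprS; ring.
Qed.

Lemma msize_curve_poly l : (0 < l)%N -> (msize (curve_poly l) <= l.+2)%N.
Proof.
move=> l0; rewrite curve_polyE; apply: leq_trans (msizeD_le _ _) _.
rewrite msizeN !msizeX !mdeg_mon; lia.
Qed.

Lemma degree_curve_poly l : (0 < l)%N -> (degree (curve_poly l) <= l.+1)%N.
Proof. by move=> /msize_curve_poly; rewrite /degree; lia. Qed.

Lemma K_set_curve l z : K_set [:: 1; curve_poly l; - curve_poly l] z <->
  eval_at (curve_poly l) z = 0.
Proof.
split=> [Kz|pz q].
  apply/eqP; rewrite eq_le; apply/andP; split.
    by rewrite -oppr_ge0 -mevalN; apply: Kz; rewrite !inE eqxx !orbT.
  by apply: Kz; rewrite !inE eqxx !orbT.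
rewrite !inE => /or3P[] /eqP ->; rewrite /eval_at ?meval1// ?mevalN.
  by rewrite -/(eval_at _ _) pz.
by rewrite -/(eval_at _ _) pz oppr0.
Qed.

(** Polarisation: q and - q both positive make the bilinear form of q zero. *)
Lemma riesz_of_opposite_localizing n (beta : truncated_seq R n) q d :
  (forall f, (msize f <= d.+1)%N -> 0 <= riesz beta (q * f * f)) ->
  (forall f, (msize f <= d.+1)%N -> 0 <= riesz beta (- q * f * f)) ->
  forall f g, (msize f <= d.+1)%N -> (msize g <= d.+1)%N ->
    riesz beta (q * (f * g)) = 0.
Proof.
move=> pos neg.
have sq0 f : (msize f <= d.+1)%N -> riesz beta (q * f * f) = 0.
  move=> fd; apply/eqP; rewrite eq_le pos// andbT -oppr_ge0 -linearN /=.
  by rewrite -!mulNr neg.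
move=> f g fd gd.
have fgd : (msize (f + g) <= d.+1)%N.
  by apply: leq_trans (msizeD_le _ _) _; rewrite geq_max fd.
have E : q * (f + g) * (f + g) = q * f * f + q * g * g + (q * (f * g)) *+ 2 by ring.
have := sq0 _ fgd; rewrite E !linearD /= !sq0// !add0r => /eqP.
by rewrite -mulr2n mulrn_eq0 /= => /eqP.
Qed.

Lemma curve_recurrence l n (beta : truncated_seq R n) d i j :
  (forall f, (msize f <= d.+1)%N -> 0 <= riesz beta (curve_poly l * f * f)) ->
  (forall f, (msize f <= d.+1)%N -> 0 <= riesz beta (- curve_poly l * f * f)) ->
  (i + j <= 2 * d)%N ->
  riesz beta (mpolyX R (mon i.+1 j.+1)) = riesz beta (mpolyX R (mon i (j + l).+1)).
Proof.
move=> pos neg ijd; apply/eqP; rewrite -subr_eq0 -linearB /= -curve_polyX.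
have ij : (mdeg (mon i j) < (2 * d).+1)%N by rewrite mdeg_mon.
have [m1 [m2 /= ->]] := monomial_split (BMultinom ij).
by rewrite mpolyXD (riesz_of_opposite_localizing pos neg) ?msizeX//; exact: bmdeg.
Qed.

Definition growth_poly n : mpoly 2 R :=
  1 + mpolyX R (mon n.+1.*2 0) + mpolyX R (mon 0 n.+1.*2).

Lemma eval_growth_poly n z : eval_at (growth_poly n) z = growth n z.
Proof.
rewrite /growth_poly /eval_at !mevalD meval1 -!/(eval_at _ z) !eval_atX !mon0 !mon1.
by rewrite expr0 mulr1 mul1r.
Qed.

Lemma msize_growth_poly n : (msize (growth_poly n) <= n.+1.*2.+1)%N.
Proof.
do 2!(apply: leq_trans (msizeD_le _ _) _; rewrite geq_max msizeX mdeg_mon ?addn0 leqnn andbT).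
by rewrite msize1.
Qed.

Definition curve l : set (R * R) := [set z | eval_at (curve_poly l) z = 0].

Lemma curve_preimage l : (0 < l)%N -> curve l =
  (fun z => pair (evals l.+1 z) (coefs l.+1 (curve_poly l))) @^-1` [set 0].
Proof.
by move=> l0; apply/seteqP; split=> z; rewrite /curve/= pair_evals ?msize_curve_poly.
Qed.

Lemma closed_curve l : (0 < l)%N -> closed (curve l).
Proof.
move=> l0; rewrite curve_preimage//; apply: preimage_closed.
  by move=> z _; exact: continuous_pair_evals.
exact: closed_eq.
Qed.

Lemma measurable_curve l : (0 < l)%N -> measurable (curve l).
Proof.
move=> l0; rewrite curve_preimage// -[X in measurable X]setTI.
have mp := @measurable_pair_evals R _ (coefs l.+1 (curve_poly l)).
exact: (mp measurableT [set 0] (measurable_set1 0)).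
Qed.

Lemma cone_raise_degree d d' (X : set (R * R)) v : (d <= d')%N ->
  cone (evals d) X v ->
  exists v', cone (evals d') X v' /\ forall f : mpoly 2 R, (msize f <= d.+1)%N ->
    pair v' (coefs d' f) = pair v (coefs d f).
Proof.
move=> dd'; elim=> [|c z {}v c0 Xz _ [v' [Xv' vv']]].
  by exists 0; split=> [|f _]; [exact: cone0 | rewrite !pair0].
exists (c *: evals d' z + v'); split; first exact: coneD.
move=> f fd; rewrite !pairD !pairZ vv' ?pair_evals//.
exact: leq_trans fd _.
Qed.

Lemma riesz_of_coefs n (beta : truncated_seq R n) v :
  riesz beta (of_coefs v) = pair (moments beta) v.
Proof.
rewrite pairE /of_coefs raddf_sum; apply: eq_bigr => i _ /=.
by rewrite linearZ /= rieszX mxE mulrC.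
Qed.

(** * From a measure to an extension and back *)

Lemma extension_of_measure l n k : (0 < l)%N -> (l < n + k)%N ->
  forall (beta : truncated_seq R n) mu,
  representing_measure [:: 1; curve_poly l; - curve_poly l] beta mu ->
  exists beta' : truncated_seq R (n + k), positive_extension beta beta' /\
    forall q, q \in [:: curve_poly l; - curve_poly l] -> psd (localizing_mx beta' q).
Proof.
move=> l0 lnk beta mu [muK mumom].
have curveE : K_set [:: 1; curve_poly l; - curve_poly l] = curve l.
  by apply/seteqP; split=> z /K_set_curve.
have Xbeta : cone (evals (2 * n)) (curve l) (moments beta).
  apply: (@measure_cone _ _ _ mu) => [||m]; [exact: measurable_curve|by rewrite -curveE|].
  by have [mi mE] := mumom m; split=> //; rewrite [LHS]mE mxE enum_rankK.
have [|v [Xv vE]] := cone_raise_degree (_ : 2 * n <= 2 * (n + k))%N Xbeta; first by lia.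
pose beta' : truncated_seq R (n + k) := [ffun m => v 0 (enum_rank m)].
have rieszE f : riesz beta' f = pair v (coefs _ f).
  rewrite -pair_moments; congr pair; apply/rowP => i.
  by rewrite mxE ffunE enum_valK.
have riesz_ge0 f : (msize f <= (2 * (n + k)).+1)%N ->
    (forall z, curve l z -> 0 <= eval_at f z) -> 0 <= riesz beta' f.
  by move=> fd f0; rewrite rieszE; apply: (cone_pair_ge0 Xv) => z Xz; rewrite pair_evals// f0.
exists beta'; split.
  apply/positive_extensionP; split=> f fd; last by rewrite rieszE vE// pair_moments.
  apply: riesz_ge0 => [|z _]; first by rewrite mul2n -addnn msizeM_bound.
  by rewrite /eval_at mevalM -expr2 sqr_ge0.
move=> q; rewrite !inE => qp.
have degq : degree q = degree (curve_poly l).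
  by case/orP: qp => /eqP ->; rewrite /degree ?msizeN.
have q0 z : curve l z -> eval_at q z = 0.
  by move=> Xz; case/orP: qp => /eqP ->; rewrite /eval_at ?mevalN -/(eval_at _ _) Xz ?oppr0.
apply/psd_localizingP => f fd; apply: riesz_ge0 => [|z Xz]; last first.
  by rewrite /eval_at !mevalM -/(eval_at q z) q0// !mul0r.
have := degree_curve_poly l0; rewrite -degq => dq.
have := msizeM_bound (msizeM_bound (leqSpred (msize q)) fd) fd.
move/leq_trans; apply; rewrite -/(degree q); lia.
Qed.

(** The squares of [positive_on_curve] have degree up to 2n + 2l, and localizing by
    a polynomial of degree l + 1 may lose one degree to parity, whence l < k. *)
Lemma measure_of_extension l n k : (0 < l)%N -> (l < k)%N ->
  forall (beta : truncated_seq R n) (beta' : truncated_seq R (n + k)),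
  positive_extension beta beta' ->
  (forall q, q \in [:: curve_poly l; - curve_poly l] -> psd (localizing_mx beta' q)) ->
  exists mu, representing_measure [:: 1; curve_poly l; - curve_poly l] beta mu.
Proof.
move=> l0 lk beta beta' /positive_extensionP[pos ext] loc.
have curveE : K_set [:: 1; curve_poly l; - curve_poly l] = curve l.
  by apply/seteqP; split=> z /K_set_curve.
pose d := (n + k - uphalf (degree (curve_poly l)))%N.
have posp f : (msize f <= d.+1)%N -> 0 <= riesz beta' (curve_poly l * f * f).
  by move: f; apply/psd_localizingP; apply: loc; rewrite !inE eqxx.
have negp f : (msize f <= d.+1)%N -> 0 <= riesz beta' (- curve_poly l * f * f).
  move: f; have /psd_localizingP : psd (localizing_mx beta' (- curve_poly l)).
    by apply: loc; rewrite !inE eqxx orbT.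
  by rewrite /degree msizeN.
have dl := degree_curve_poly l0.
have Xbeta : cone (evals (2 * n)) (curve l) (moments beta).
  apply: (@cone_of_perturbed_positivity _ _ _ _ (riesz beta' (growth_poly n))).
    exact: closed_curve.
  move=> f e e0 fpos.
  have sf : (msize (of_coefs f) <= (2 * n).+1)%N := msize_of_coefs f.
  have -> : pair (moments beta) f + e * riesz beta' (growth_poly n) =
      riesz beta' (of_coefs f + e *: growth_poly n).
    by rewrite [RHS]linearD linearZ /= (ext _ sf) riesz_of_coefs.
  have Fpos z : curve l z -> 0 <= eval_at (of_coefs f + e *: growth_poly n) z.
    move=> Xz; rewrite /eval_at mevalD mevalZ -!/(eval_at _ z) eval_growth_poly.
    by rewrite -pair_evals_of_coefs fpos.
  apply: (@positive_on_curve _ l n) => //.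
  - by move=> g gd; apply: pos; apply: leq_trans gd _; lia.
  - move=> i j ij; apply: (@curve_recurrence _ _ _ d) => //; rewrite /d; lia.
  - apply: leq_trans (msizeD_le _ _) _; rewrite geq_max; apply/andP; split.
      by apply: leq_trans sf _; lia.
    exact: leq_trans (msizeZ_le _ _) (msize_growth_poly n).
  - by move=> t; apply: Fpos; rewrite /curve /= eval_curve_poly /= mul0r.
  - by move=> t; apply: Fpos; rewrite /curve /= eval_curve_poly /= subrr mulr0.
have [mu [muX mum]] := cone_measure Xbeta.
exists mu; split; first by rewrite curveE.
by move=> m; have [mi mE] := mum m; split=> //; rewrite [LHS]mE mxE enum_rankK.
Qed.

End CurvePositivity.

Theorem theorem4p6 (R : realType) (l : nat) (hl : (1 <= l)%N)
    (n : nat) (hn : (l + 1 <= n)%N) :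
  let p : mpoly 2 R := varY * (varX - varY ^+ l) in
  property_S n (l + maxn (l - 1) 2) [:: 1; p; - p].
Proof.
move=> p beta; split=> [[mu mubeta]|[beta' [ext loc]]].
  by apply: (extension_of_measure hl _ mubeta); lia.
by apply: (measure_of_extension hl _ ext loc); lia.
Qed.
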